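(* Let $U$ be a nonempty closed convex subset of $V$; let $\mathcal{B}:Q\to Q$ be a linear continuous operator for which there exists $m_{\mathcal B}>0$ with $(\mathcal{B}\boldsymbol\tau,\boldsymbol\tau)_Q\ge m_{\mathcal B}\|\boldsymbol\tau\|_Q^2$ for all $\boldsymbol\tau\in Q$; let $\mathcal{R}\in C([0,T];\mathbf{Q}_\infty)$; let $P:V\to V^*$ be a Lipschitz continuous monotone operator; and let $\boldsymbol f\in C([0,T];V^* )$. Let $\mathcal F:V^*\to U$ be the solution operator defined in the context. Let $\boldsymbol u\in C([0,T];U)$. Then the following are equivalent: (1) ($\boldsymbol u$ solves Problem $\mathcal P$) for all $t\in[0,T]$, $\boldsymbol u(t)\in U$ and $$(\mathcal{B}\boldsymbol\varepsilon(\boldsymbol u(t)),\boldsymbol\varepsilon(\boldsymbol v)-\boldsymbol\varepsilon(\boldsymbol u(t)))_Q+\Big(\int_0^t\mathcal{R}(t-s)\boldsymbol\varepsilon(\boldsymbol u(s))\,ds,\boldsymbol\varepsilon(\boldsymbol v)-\boldsymbol\varepsilon(\boldsymbol u(t))\Big)_Q+\langle P\boldsymbol u(t),\boldsymbol v-\boldsymbol u(t)\rangle\ge\langle\boldsymbol f(t),\boldsymbol v-\boldsymbol u(t)\rangle\quad\forall\,\boldsymbol v\in U;$$ (2) ($\boldsymbol u$ solves Problem $\mathcal Q$) for all $t\in[0,T]$, $$\boldsymbol u(t)=\mathcal F\Big[\boldsymbol f(t)-\boldsymbol\varepsilon^*\Big(\int_0^t\mathcal{R}(t-s)\boldsymbol\varepsilon(\boldsymbol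 u(s))\,ds\Big)\Big].$$
   Context: Let $d\in\{1,2,3\}$, $\Omega\subset\mathbb R^d$ a bounded domain with smooth boundary $\Gamma$, $\Gamma_1\subset\Gamma$ a measurable part with positive $(d-1)$-dimensional measure, and $T>0$. Put $V=\{\boldsymbol v=(v_i)\in H^1(\Omega)^d: v_i=0\text{ on }\Gamma_1,\ i=1,\dots,d\}$ (in the sense of traces) and $Q=\{\boldsymbol\sigma=(\sigma_{ij}):\sigma_{ij}=\sigma_{ji}\in L^2(\Omega),\ i,j=1,\dots,d\}$. For $\boldsymbol v\in V$, $\boldsymbol\varepsilon(\boldsymbol v)=\frac12(\nabla\boldsymbol v+\nabla\boldsymbol v^T)\in Q$. $V$ and $Q$ are Hilbert spaces with inner products $(\boldsymbol u,\boldsymbol v)_V=\int_\Omega\boldsymbol\varepsilon(\boldsymbol u)\cdot\boldsymbol\varepsilon(\boldsymbol v)\,dx$ and $(\boldsymbol\sigma,\boldsymbol\tau)_Q=\int_\Omega\boldsymbol\sigma\cdot\boldsymbol\tau\,dx$, where $\cdot$ is the Euclidean inner product. $V^*$ is the dual of $V$, with duality pairing $\langle\cdot,\cdot\rangle$. $\mathbf{Q}_\infty$ is the Banach space of fourth order tensors $\mathcal D=(D_{ijkl})$ with $D_{ijkl}=D_{jikl}=D_{klij}\in L^\infty(\Omega)$, normed by $\max_{i,j,k,l}\|D_{ijkl}\|_{L^\infty(\Omega)}$; it acts on $Q$ by $(\mathcal D\boldsymbol\tau)_{ij}=\sum_{k,l}D_{ijkl}\tau_{kl}$. For a normed space $X$,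 $C([0,T];X)$ has the maximum norm, and for $K\subset X$, $C([0,T];K)$ is the set of functions in $C([0,T];X)$ with values in $K$. $\boldsymbol\varepsilon^*:Q\to V^*$ is the adjoint of $\boldsymbol\varepsilon:V\to Q$: $\langle\boldsymbol\varepsilon^*(\boldsymbol\eta),\boldsymbol v\rangle=(\boldsymbol\eta,\boldsymbol\varepsilon(\boldsymbol v))_Q$. Set $\mathcal W=\boldsymbol\varepsilon^*\mathcal B\boldsymbol\varepsilon:V\to V^*$. The operator $\mathcal F:V^*\to U$ assigns to $\boldsymbol\omega\in V^*$ the unique element $\boldsymbol z\in U$ with $\langle(\mathcal W+P)(\boldsymbol z),\boldsymbol v-\boldsymbol z\rangle\ge\langle\boldsymbol\omega,\boldsymbol v-\boldsymbol z\rangle$ for all $\boldsymbol v\in U$ (existence and uniqueness of $\boldsymbol z$ is standard under the hypotheses on $U,\mathcal B,P$). *)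

(* Defs.v *)
From HB Require Import structures.
From mathcomp Require Import all_boot all_order all_algebra.
From mathcomp Require Import all_classical all_reals all_analysis.
From mathcomp Require Import measurable_realfun ess_sup_inf.
From mathcomp Require Import ring.

Set Implicit Arguments.
Unset Strict Implicit.
Unset Printing Implicit Defensive.

Import Order.TTheory GRing.Theory Num.Theory.
Import numFieldNormedType.Exports.

Local Open Scope classical_set_scope.
Local Open Scope ring_scope.

(* L^p as the quotient of LfunType by equality almost everywhere; unlike the  *)
(* LspaceType of hoelder.v, it carries a linear structure.                    *)
Section Lp_space.
Context d (T : measurableType d) (R : realType).
Variables (mu : {measure set T -> \bar R}) (p : \bar R) (p1 : (1 <= p)%E).

Definition Lp_eq (f g : LfunType mu p1) : bool := `[< f = g %[ae mu] >].

Let Lp_eq_refl : reflexive Lp_eq.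
Proof. by move=> f; apply/asboolP; exact: nearW. Qed.

Let Lp_eq_sym : symmetric Lp_eq.
Proof.
by move=> f g; apply/asboolP/asboolP; apply: filterS => x + /[dup] => /[apply].
Qed.

Let Lp_eq_trans : transitive Lp_eq.
Proof.
move=> f g h /asboolP gf /asboolP fh; apply/asboolP.
by apply: filterS2 gf fh => x gf fh Tx; rewrite gf// fh.
Qed.

Canonical Lp_eq_equiv := EquivRel Lp_eq Lp_eq_refl Lp_eq_sym Lp_eq_trans.

Local Open Scope quotient_scope.

Definition Lp : Type := {eq_quot Lp_eq}.
HB.instance Definition _ := Choice.on Lp.
HB.instance Definition _ := EqQuotient.on Lp.

Definition Lp_fun (x : Lp) : T -> R := repr x : LfunType mu p1.
Coercion Lp_fun : Lp >-> Funclass.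

Lemma Lp_piP (f g : LfunType mu p1) :
  \pi_Lp f = \pi_Lp g <-> f = g %[ae mu].
Proof.
split=> [/eqP|fg]; first by rewrite eqmodE => /asboolP.
by apply/eqP; rewrite eqmodE; apply/asboolP.
Qed.

Lemma Lp_piE (f : LfunType mu p1) : (\pi_Lp f : Lp) = f %[ae mu].
Proof. by apply/Lp_piP; rewrite reprK. Qed.

Lemma LpP (x y : Lp) : x = y <-> x = y %[ae mu].
Proof. by rewrite -Lp_piP !reprK. Qed.

Lemma Lp_memP (x : Lp) : (x : T -> R) \in Lfun mu p.
Proof. exact: LfunP. Qed.

Definition Lp_zero : Lp := \pi_Lp 0.
Definition Lp_opp (x : Lp) : Lp := \pi_Lp (- repr x).
Definition Lp_add (x y : Lp) : Lp := \pi_Lp (repr x + repr y).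
Definition Lp_scale (a : R) (x : Lp) : Lp := \pi_Lp (a *: repr x).

Let Lp_addE f g : Lp_add (\pi_Lp f) (\pi_Lp g) = \pi_Lp (f + g).
Proof.
apply/Lp_piP; apply: filterS2 (Lp_piE f) (Lp_piE g) => x ff gg Tx.
by rewrite /= -[LHS]/(Lp_fun _ x + Lp_fun _ x) ff// gg.
Qed.

Let Lp_scaleE a f : Lp_scale a (\pi_Lp f) = \pi_Lp (a *: f).
Proof.
apply/Lp_piP; apply: filterS (Lp_piE f) => x ff Tx.
by rewrite /= -[LHS]/(a *: Lp_fun _ x) ff.
Qed.

Let Lp_ind (P : Lp -> Prop) : (forall f, P (\pi_Lp f)) -> forall x, P x.
Proof. by move=> Pf x; rewrite -[x]reprK. Qed.

Let Lp_addA : associative Lp_add.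
Proof.
by elim/Lp_ind=> f; elim/Lp_ind=> g; elim/Lp_ind=> h; rewrite !Lp_addE addrA.
Qed.

Let Lp_addC : commutative Lp_add.
Proof. by elim/Lp_ind=> f; elim/Lp_ind=> g; rewrite !Lp_addE addrC. Qed.

Let Lp_add0 : left_id Lp_zero Lp_add.
Proof. by elim/Lp_ind=> f; rewrite Lp_addE add0r. Qed.

Let Lp_addN : left_inverse Lp_zero Lp_opp Lp_add.
Proof.
move=> x; rewrite -{2}[x]reprK /Lp_opp Lp_addE; congr (\pi_Lp _).
exact: addNr.
Qed.

HB.instance Definition _ :=
  GRing.isZmodule.Build Lp Lp_addA Lp_addC Lp_add0 Lp_addN.

Let Lp_scaleA a b x : Lp_scale a (Lp_scale b x) = Lp_scale (a * b) x.
Proof. by elim/Lp_ind: x => f; rewrite !Lp_scaleE scalerA. Qed.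

Let Lp_scale1 : left_id 1 Lp_scale.
Proof. by elim/Lp_ind=> f; rewrite Lp_scaleE scale1r. Qed.

Let Lp_scaleDr : right_distributive Lp_scale +%R.
Proof.
move=> a; elim/Lp_ind=> f; elim/Lp_ind=> g.
by rewrite -[_ + _]/(Lp_add _ _) Lp_addE !Lp_scaleE scalerDr -Lp_addE.
Qed.

Let Lp_scaleDl x : {morph Lp_scale^~ x : a b / a + b}.
Proof.
move=> a b; elim/Lp_ind: x => f.
by rewrite !Lp_scaleE scalerDl -Lp_addE.
Qed.

HB.instance Definition _ := GRing.Zmodule_isLmodule.Build R Lp
  Lp_scaleA Lp_scale1 Lp_scaleDr Lp_scaleDl.

Lemma LpDE (x y : Lp) : (x + y : Lp) = (fun t => x t + y t) %[ae mu].
Proof. exact: Lp_piE. Qed.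

Lemma LpZE a (x : Lp) : (a *: x : Lp) = (fun t => a * x t) %[ae mu].
Proof. exact: Lp_piE. Qed.

Definition Lp_norm (x : Lp) : R := fine ('N[mu]_p[EFin \o x])%E.

End Lp_space.

Notation L2 mu := (Lp mu (lee1n 2)).
Notation Linfty mu := (Lp mu (leey 1%E)).

Section L2_Linfty.
Context d (T : measurableType d) (R : realType).
Variable mu : {measure set T -> \bar R}.

Definition L2_inner (x y : L2 mu) : R := \int[mu]_t (x t * y t).

Lemma L2_mul_integrable (x y : L2 mu) :
  mu.-integrable setT (EFin \o (fun t => x t * y t)).
Proof.
by apply/Lfun1_integrable; apply: Lfun2_mul_Lfun1; exact: Lp_memP.
Qed.

Lemma L2_inner_sym (x y : L2 mu) : L2_inner x y = L2_inner y x.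
Proof. by apply: eq_Rintegral => t _; rewrite mulrC. Qed.

Lemma L2_inner_ge0 (x : L2 mu) : 0 <= L2_inner x x.
Proof. by apply: Rintegral_ge0 => t _; rewrite -expr2 sqr_ge0. Qed.

Lemma L2_inner_linear a (x y z : L2 mu) :
  L2_inner (a *: x + y) z = a * L2_inner x z + L2_inner y z.
Proof.
have iaxz : mu.-integrable setT (EFin \o (fun t => a * (x t * z t))).
  have /(integrableZl measurableT a) := L2_mul_integrable x z.
  by apply: eq_integrable => // t _ /=; rewrite EFinM.
rewrite /L2_inner -RintegralZl//; last exact: L2_mul_integrable.
rewrite -RintegralD//; last exact: L2_mul_integrable.
congr fine; apply: ae_eq_integral => //.
- exact: (measurable_int _ (L2_mul_integrable (a *: x + y) z)).
- have := integrableD measurableT iaxz (L2_mul_integrable y z).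
  by move/measurable_int; exact: eq_measurable_fun.
apply: filterS2 (LpDE (a *: x) y) (LpZE a x) => t + + Tt.
by move=> -> // -> //; rewrite mulrDl mulrA.
Qed.

Lemma Linfty_mul_subproof (f : Linfty mu) (x : L2 mu) :
  (fun t => f t * x t) \in Lfun mu 2%:E.
Proof.
have /andP[/[!inE]/= mf ff] := Lp_memP f.
have /andP[/[!inE]/= mx fx] := Lp_memP x.
have [M fM] : exists M, \forall t \ae mu, `|f t| <= M.
  have [mu0|mu0] := ltP 0%E (mu setT).
    apply: ess_supr_bounded; move: ff.
    by rewrite /finite_norm unlock mu0.
  exists 0; exists setT; split => //.
  by apply/eqP; rewrite eq_le mu0 measure_ge0.
apply/andP; split; rewrite inE/=; first exact: measurable_funM.
have mfx : measurable_fun setT (EFin \o (fun t => f t * x t)).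
  by apply/measurable_EFinP; exact: measurable_funM.
have ix : mu.-integrable setT (fun t => (M ^+ 2 * `|x t| `^ 2)%:E).
  have := Lfun_integrable (ler1n _ _ : 1 <= 2) (Lp_memP x).
  move/(integrableZl measurableT (M ^+ 2)).
  by apply: eq_integrable => // t _ /=; rewrite EFinM.
rewrite /finite_norm unlock poweR_lty//=.
apply: le_lt_trans (integrable_lty measurableT ix).
apply: ae_ge0_le_integral => //.
- apply/measurable_EFinP/(measurableT_comp (measurable_powR _)) => //.
  by apply: measurableT_comp => //; exact: measurable_funM.
- by move=> t _; rewrite lee_fin mulr_ge0 ?sqr_ge0 ?powR_ge0.
- exact: measurable_int ix.
apply: filterS fM => t fM _.
rewrite lee_fin normrM !powR_mulrn// exprMn ler_wpM2r ?sqr_ge0//.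
by rewrite lerXn2r// nnegrE (le_trans _ fM).
Qed.

Definition Linfty_mul (f : Linfty mu) (x : L2 mu) : L2 mu :=
  (\pi_(L2 mu) (Lfun_Sub (lee1n 2) (Linfty_mul_subproof f x)))%qT.

Lemma Linfty_mulE (f : Linfty mu) (x : L2 mu) :
  Linfty_mul f x = (fun t => f t * x t) %[ae mu].
Proof. exact: Lp_piE. Qed.

End L2_Linfty.

Section outer_measures.
Context (R : realType) (d : nat).
Local Notation E := 'rV[R]_d.

(* Every subset of E is measurable in this type, so that covers by arbitrary  *)
(* sets are allowed in mu_ext.                                                *)
Definition powerset_type : Type := g_sigma_algebraType [set: set E].

(* the empty set has size 0 whatever g is                                     *)
Definition gauge0 (g : set E -> \bar R) (A : set E) : \bar R :=
  if `[< A = set0 >] then 0%E else g A.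

Definition cover_outer (g : set E -> \bar R) : set E -> \bar R :=
  @mu_ext _ powerset_type R (gauge0 g).

Section cover_outer_theory.
Variable g : set E -> \bar R.
Hypothesis g_ge0 : forall A, A !=set0 -> (0 <= g A)%E.

Let g0 : gauge0 g set0 = 0%E.
Proof. by rewrite /gauge0; case: asboolP. Qed.

Let gge0 (A : set E) : (0 <= gauge0 g A)%E.
Proof. by rewrite /gauge0; case: asboolP => // /eqP/set0P; exact: g_ge0. Qed.

Lemma cover_outer0 : cover_outer g set0 = 0%E.
Proof. exact: (@mu_ext0 _ powerset_type R _ g0 gge0). Qed.

Lemma cover_outer_ge0 X : (0 <= cover_outer g X)%E.
Proof. exact: (@mu_ext_ge0 _ powerset_type R _ gge0). Qed.

Lemma le_cover_outer : {homo cover_outer g : A B / A `<=` B >-> (A <= B)%E}.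
Proof. exact: (@le_mu_ext _ powerset_type R). Qed.

Lemma cover_outer_sigma_subadditive : sigma_subadditive (cover_outer g).
Proof. exact: (@mu_ext_sigma_subadditive _ powerset_type R _ gge0). Qed.

End cover_outer_theory.

Definition box (ab : E * E) : set E :=
  [set x | forall i, ab.1 ord0 i <= x ord0 i <= ab.2 ord0 i].

(* least volume of a closed box containing A (+oo if A is unbounded)          *)
Definition box_gauge (A : set E) : \bar R :=
  ereal_inf [set (\prod_i (ab.2 ord0 i - ab.1 ord0 i))%:E | ab in
    [set ab : E * E |
      (forall i, ab.1 ord0 i <= ab.2 ord0 i) /\ A `<=` box ab]].

Lemma box_gauge_ge0 A : A !=set0 -> (0 <= box_gauge A)%E.
Proof.
move=> _; apply: le_ereal_inf_tmp => _ [ab [abi _] <-].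
by rewrite lee_fin prodr_ge0// => i _; rewrite subr_ge0.
Qed.

Definition lebesgue_outer := cover_outer box_gauge.

HB.instance Definition _ := isOuterMeasure.Build R E lebesgue_outer
  (cover_outer0 box_gauge_ge0) (cover_outer_ge0 box_gauge_ge0)
  (@le_cover_outer box_gauge) (cover_outer_sigma_subadditive box_gauge_ge0).

Definition diameter (A : set E) : \bar R :=
  ereal_sup [set (Num.sqrt (\sum_i (x ord0 i - y ord0 i) ^+ 2))%:E
              | x in A & y in A].

Definition diameter_gauge (s : nat) (delta : R) (A : set E) : \bar R :=
  if (diameter A <= delta%:E)%E then (diameter A ^+ s)%E else +oo%E.

Lemma diameter_gauge_ge0 s delta A :
  A !=set0 -> (0 <= diameter_gauge s delta A)%E.
Proof.
move=> [x Ax]; rewrite /diameter_gauge; case: ifPn => // _; apply: expe_ge0.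
apply: ereal_sup_ubound; exists x => //; exists x => //; congr EFin.
by rewrite big1 ?sqrtr0// => i _; rewrite subrr expr0n.
Qed.

(* s-dimensional Hausdorff outer measure, without normalizing constant; on    *)
(* smooth hypersurfaces of R^d the (d-1)-dimensional one is a positive        *)
(* multiple of the surface measure, and it counts points if s = 0.            *)
Definition hausdorff_outer (s : nat) (X : set E) : \bar R :=
  ereal_sup [set cover_outer (diameter_gauge s delta) X | delta in
    [set delta | 0 < delta]].

Section hausdorff_theory.
Variable s : nat.

Lemma hausdorff_outer_ge0 X : (0 <= hausdorff_outer s X)%E.
Proof.
apply: le_trans (cover_outer_ge0 (@diameter_gauge_ge0 s 1) X) _.
by apply: ereal_sup_ubound; exists 1 => //=.
Qed.

Lemma hausdorff_outer0 : hausdorff_outer s set0 = 0%E.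
Proof.
apply/eqP; rewrite eq_le hausdorff_outer_ge0 andbT.
apply: ge_ereal_sup => _ [delta _ <-].
by rewrite cover_outer0//; exact: diameter_gauge_ge0.
Qed.

Lemma le_hausdorff_outer :
  {homo hausdorff_outer s : A B / A `<=` B >-> (A <= B)%E}.
Proof.
move=> A B AB; apply: ge_ereal_sup => _ [delta delta0 <-].
apply: le_trans (le_cover_outer _ AB) _.
by apply: ereal_sup_ubound; exists delta.
Qed.

Lemma hausdorff_outer_sigma_subadditive :
  sigma_subadditive (hausdorff_outer s).
Proof.
move=> F; apply: ge_ereal_sup => _ [delta delta0 <-].
apply: le_trans
  (cover_outer_sigma_subadditive (@diameter_gauge_ge0 s delta) F) _.
apply: lee_nneseries => [n _ _|n _].
  exact/cover_outer_ge0/diameter_gauge_ge0.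
by apply: ereal_sup_ubound; exists delta.
Qed.

HB.instance Definition _ := isOuterMeasure.Build R E (hausdorff_outer s)
  hausdorff_outer0 hausdorff_outer_ge0 le_hausdorff_outer
  hausdorff_outer_sigma_subadditive.

End hausdorff_theory.

Section outer_restriction.
Variables (mu : {outer_measure set E -> \bar R}) (D : set E).

Definition outer_restr (X : set E) : \bar R := mu (X `&` D).

Let outer_restr0 : outer_restr set0 = 0%E.
Proof. by rewrite /outer_restr set0I outer_measure0. Qed.

Let outer_restr_ge0 X : (0 <= outer_restr X)%E.
Proof. exact: outer_measure_ge0. Qed.

Let le_outer_restr : {homo outer_restr : A B / A `<=` B >-> (A <= B)%E}.
Proof. by move=> A B AB; apply: le_outer_measure; exact: setSI. Qed.

Let outer_restr_sigma_subadditive : sigma_subadditive outer_restr.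
Proof.
move=> F; rewrite /outer_restr setI_bigcupl.
exact: outer_measure_sigma_subadditive.
Qed.

HB.instance Definition _ := isOuterMeasure.Build R E outer_restr
  outer_restr0 outer_restr_ge0 le_outer_restr outer_restr_sigma_subadditive.

End outer_restriction.

(* the measure given by an outer measure on its measurable sets               *)
Definition of_outer (mu : {outer_measure set E -> \bar R}) :
  {measure set (caratheodory_type mu) -> \bar R} := mu.

End outer_measures.

(* Smooth functions on R^d and bounded domains with smooth boundary.          *)
Section smooth_domains.
Context (R : realType) (d : nat).
Local Notation E := 'rV[R]_d.

Definition partial (i : 'I_d) (f : E -> R) : E -> R :=
  fun x => 'D_(delta_mx ord0 i) f x.

Definition smooth (f : E -> R) : Prop := forall s : seq 'I_d,
  continuous (foldr partial f s) /\
  forall i x, derivable (foldr partial f s) x (delta_mx ord0 i).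

Definition test_function (Omega : set E) (f : E -> R) : Prop :=
  [/\ smooth f, compact (closure [set x | f x != 0]) &
      closure [set x | f x != 0] `<=` Omega].

Definition boundary (A : set E) : set E := closure A `\` A^°.

(* near each of its boundary points, the open set Omega is the side rho < 0   *)
(* of the hypersurface rho = 0 with nonzero gradient                          *)
Definition smooth_boundary (Omega : set E) : Prop :=
  forall x, boundary Omega x -> exists rho : E -> R,
    [/\ smooth rho, exists i, partial i rho x != 0 &
        \forall y \near x, Omega y <-> rho y < 0].

Definition bounded_smooth_domain (Omega : set E) : Prop :=
  [/\ open Omega, connected Omega, Omega !=set0, bounded_set Omega &
      smooth_boundary Omega].

Lemma foldr_partial_linear (s : seq 'I_d) a (f g : E -> R) :
  smooth f -> smooth g -> foldr partial (a *: f + g) s =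
    a *: foldr partial f s + foldr partial g s.
Proof.
move=> sf sg; elim: s => //= i s ->; apply/funext => x; rewrite /partial.
have [_ df] := sf s; have [_ dg] := sg s.
by rewrite deriveD ?deriveZ//; exact: derivableZ.
Qed.

Lemma partial_linear i a (f g : E -> R) : smooth f -> smooth g ->
  partial i (a *: f + g) = a *: partial i f + partial i g.
Proof. by move=> sf sg; exact: (@foldr_partial_linear [:: i]). Qed.

Lemma smooth_linear a (f g : E -> R) :
  smooth f -> smooth g -> smooth (a *: f + g).
Proof.
move=> sf sg s; rewrite foldr_partial_linear//.
have [cf df] := sf s; have [cg dg] := sg s; split=> [x|i x].
  apply: (@continuousD _ _ _ (a *: foldr partial f s)); last exact: cg.
  exact: (cvgZ (cvg_cst a) (cf x)).
by apply: derivableD => //; exact: derivableZ.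
Qed.

Lemma partial0 i : partial i 0 = 0.
Proof. by apply/funext => x; rewrite /partial; exact: derive_cst. Qed.

Lemma smooth0 : smooth 0.
Proof.
move=> s; have -> : foldr partial 0 s = 0.
  by elim: s => //= i s ->; exact: partial0.
by split=> [x|i x]; [exact: cst_continuous|exact: derivable_cst].
Qed.

End smooth_domains.

(* The norm of V is only a seminorm until Korn's inequality is known, so that *)
(* the space cannot be declared as a normedModType here: the following metric *)
(* notions take the norm nrm as an explicit argument.                         *)
Section normed_notions.
Context (R : realType).

Definition cvg_in (E : lmodType R) (nrm : E -> R) (x_ : nat -> E) (x : E) :=
  nrm (x_ n - x) @[n --> \oo] --> (0 : R).

Definition closed_in (E : lmodType R) (nrm : E -> R) (U : set E) :=
  forall x_ x, (forall n, U (x_ n)) -> cvg_in nrm x_ x -> U x.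

Definition convex_in (E : lmodType R) (U : set E) :=
  forall x y (l : R), U x -> U y -> 0 <= l <= 1 -> U (l *: x + (1 - l) *: y).

Definition continuous_in (E F : lmodType R) (nE : E -> R) (nF : F -> R)
    (f : E -> F) :=
  forall x e, 0 < e -> exists2 delta, 0 < delta &
    forall y, nE (y - x) < delta -> nF (f y - f x) < e.

Definition lipschitz_in (E F : lmodType R) (nE : E -> R) (nF : F -> R)
    (f : E -> F) :=
  exists L : R, forall x y, nF (f x - f y) <= L * nE (x - y).

Definition continuous_on_time (E : lmodType R) (nrm : E -> R) (T : R)
    (u : R -> E) :=
  forall t, 0 <= t <= T ->
    nrm (u s - u t) @[s --> within `[0, T] (nbhs t)] --> (0 : R).

Definition is_riemann_integral (E : lmodType R) (nrm : E -> R) (g : R -> E)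
    (a b : R) (I : E) :=
  forall e, 0 < e -> exists2 delta, 0 < delta &
    forall (n : nat) (s xi : nat -> R),
      s 0 = a -> s n = b ->
      (forall i, (i < n)%N -> s i <= xi i <= s i.+1) ->
      (forall i, (i < n)%N -> s i.+1 - s i < delta) ->
      nrm (\sum_(0 <= i < n) (s i.+1 - s i) *: g (xi i) - I) < e.

(* the limit exists and is unique if g is continuous and E is a Banach space  *)
Definition riemann_integral (E : lmodType R) (nrm : E -> R) (g : R -> E)
    (a b : R) : E :=
  xget 0 [set I | is_riemann_integral nrm g a b I].

Definition ip_norm (E : lmodType R) (ip : E -> E -> R) (x : E) : R :=
  Num.sqrt (ip x x).

Definition hilbert (E : lmodType R) (ip : E -> E -> R) : Prop :=
  [/\ forall x y, ip x y = ip y x,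
      forall a x y z, ip (a *: x + y) z = a * ip x z + ip y z,
      forall x, 0 <= ip x x,
      forall x, ip x x = 0 -> x = 0 &
      forall x_ : nat -> E,
        (forall e, 0 < e -> exists N, forall m n, (N <= m)%N -> (N <= n)%N ->
           ip_norm ip (x_ m - x_ n) < e) ->
        exists x, cvg_in (ip_norm ip) x_ x].

Section cauchy_schwarz.
Variables (E : lmodType R) (ip : E -> E -> R).
Hypothesis ipC : forall x y, ip x y = ip y x.
Hypothesis ip_linear :
  forall a x y z, ip (a *: x + y) z = a * ip x z + ip y z.
Hypothesis ip_ge0 : forall x, 0 <= ip x x.

Lemma ip_cauchy_schwarz x y : `|ip x y| <= ip_norm ip x * ip_norm ip y.
Proof.
have pol a : 0 <= a ^+ 2 * ip x x + 2 * a * ip x y + ip y y.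
  have := ip_ge0 (a *: x + y).
  rewrite ip_linear (ipC x) (ipC y (_ + _)) !ip_linear (ipC y x).
  suff -> : a * (a * ip x x + ip x y) + (a * ip x y + ip y y) =
    a ^+ 2 * ip x x + 2 * a * ip x y + ip y y by [].
  by ring.
have h : ip x y ^+ 2 <= ip x x * ip y y.
  have [xx0|xx0] := eqVneq (ip x x) 0.
    rewrite xx0 mul0r.
    have [->|xy0] := eqVneq (ip x y) 0; first by rewrite expr0n.
    have := pol (- (ip y y + 1) / (2 * ip x y)); rewrite xx0.
    set r := (X in 0 <= X); suff -> : r = -1 by rewrite ler0N1.
    by rewrite /r; field.
  have xx_gt0 : 0 < ip x x by rewrite lt_def xx0 ip_ge0.
  have := pol (- ip x y / ip x x); rewrite -(ler_pM2l xx_gt0) mulr0.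
  set r := (X in 0 <= X); suff -> : r = ip x x * ip y y - ip x y ^+ 2.
    by rewrite subr_ge0.
  by rewrite /r; field.
by rewrite /ip_norm -sqrtrM// -[leLHS]sqrtr_sqr ler_wsqrtr.
Qed.

Lemma ip_normD x y : ip_norm ip (x + y) <= ip_norm ip x + ip_norm ip y.
Proof.
rewrite -ler_sqr ?nnegrE ?addr_ge0 ?sqrtr_ge0//.
have -> : ip_norm ip (x + y) ^+ 2 =
    ip_norm ip x ^+ 2 + ip x y *+ 2 + ip_norm ip y ^+ 2.
  rewrite !sqr_sqrtr//; have := ip_linear 1 x y; rewrite scale1r => ipD.
  rewrite ipD (ipC x) (ipC y (_ + _)) !ipD (ipC y x) !mul1r mulr2n; ring.
rewrite sqrrD lerD2r lerD2l lerMn2r/=.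
exact: le_trans (ler_norm _) (ip_cauchy_schwarz x y).
Qed.

Lemma ip_normZ a x : ip_norm ip (a *: x) = `|a| * ip_norm ip x.
Proof.
have ip0 z : ip 0 z = 0.
  have := ip_linear 0 0 z z; rewrite scale0r add0r mul0r add0r => /eqP.
  have := ip_linear (-1) 0 0 z; rewrite scaler0 add0r.
  by rewrite mulN1r addNr.
have ipZ y z : ip (a *: y) z = a * ip y z.
  by have := ip_linear a y 0 z; rewrite addr0 ip0 addr0.
by rewrite /ip_norm ipZ ipC ipZ mulrA -expr2 sqrtrM ?sqr_ge0// sqrtr_sqr.
Qed.

Lemma cvg_in_linear a (x_ y_ : nat -> E) x y :
  cvg_in (ip_norm ip) x_ x -> cvg_in (ip_norm ip) y_ y ->
  cvg_in (ip_norm ip) (fun n => a *: x_ n + y_ n) (a *: x + y).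
Proof.
move=> cx cy; rewrite /cvg_in.
apply: (@squeeze_cvgr _ _ _ _ (cst 0)
    (fun n => `|a| * ip_norm ip (x_ n - x) + ip_norm ip (y_ n - y))).
- apply: nearW => n; rewrite /= sqrtr_ge0/= -ip_normZ.
  rewrite opprD addrACA -scalerBr; exact: ip_normD.
- exact: cvg_cst.
rewrite -[X in _ --> X]addr0 -[X in _ --> X + _](mulr0 `|a|).
by apply: cvgD => //; apply: cvgM => //; exact: cvg_cst.
Qed.

Lemma cvg_in_cst x : cvg_in (ip_norm ip) (fun=> x) x.
Proof.
rewrite /cvg_in subrr; have -> : ip_norm ip 0 = 0.
  by rewrite -(scale0r x) ip_normZ normr0 mul0r.
exact: cvg_cst.
Qed.

End cauchy_schwarz.

End normed_notions.

Section function_spaces.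
Context (R : realType) (d : nat).
Local Notation E := 'rV[R]_d.
Variables (Omega Gamma1 : set E).

(* Lebesgue measure of Omega and (d-1)-dimensional measure of its boundary,   *)
(* as measures on R^d for which the complement is negligible.                 *)
Definition volume_on := of_outer (outer_restr (@lebesgue_outer R d) Omega).

Definition surface_on :=
  of_outer (outer_restr (@hausdorff_outer R d d.-1) (boundary Omega)).

Local Notation L2O := (L2 volume_on).
Local Notation L2G := (L2 surface_on).

(* v has weak j-th partial derivative g: int v d_j f = - int g f for all test *)
(* functions f, where phi and dphi are the classes of f and d_j f.            *)
Definition weak_partial (j : 'I_d) (v g : L2O) : Prop :=
  forall (f : E -> R) (phi dphi : L2O), test_function Omega f ->
    phi = f %[ae volume_on] -> dphi = partial j f %[ae volume_on] ->
    L2_inner v dphi = - L2_inner g phi.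

(* An element of H^1(Omega) is represented by the pair of its class in        *)
(* L^2(Omega) and of its weak gradient, which is unique.                      *)
Definition in_H1 (w : L2O * ('I_d -> L2O)) : Prop :=
  forall j, weak_partial j w.1 (w.2 j).

Definition H1_inner (w z : L2O * ('I_d -> L2O)) : R :=
  L2_inner w.1 z.1 + \sum_j L2_inner (w.2 j) (z.2 j).

(* The trace is the continuous extension of the restriction to the boundary   *)
(* of functions that are smooth up to the boundary.                           *)
Definition is_trace (w : L2O * ('I_d -> L2O)) (g : L2G) : Prop :=
  exists (f_ : nat -> E -> R) (w_ : nat -> L2O * ('I_d -> L2O))
      (g_ : nat -> L2G),
    [/\ forall n, [/\ smooth (f_ n), (w_ n).1 = f_ n %[ae volume_on],
          forall j, (w_ n).2 j = partial j (f_ n) %[ae volume_on] &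
          g_ n = f_ n %[ae surface_on]],
        cvg_in (ip_norm H1_inner) w_ w &
        cvg_in (ip_norm (@L2_inner _ _ _ surface_on)) g_ g].

Definition V_pred (v : ('I_d -> L2O) * ('I_d -> 'I_d -> L2O)) : bool :=
  `[< forall i, in_H1 (v.1 i, v.2 i) /\
        exists2 g, is_trace (v.1 i, v.2 i) g &
          \forall x \ae surface_on, Gamma1 x -> g x = 0 >].

Lemma H1_inner_sym w z : H1_inner w z = H1_inner z w.
Proof.
rewrite /H1_inner L2_inner_sym; congr (_ + _).
by apply: eq_bigr => j _; rewrite L2_inner_sym.
Qed.

Lemma H1_inner_linear a w w' z :
  H1_inner (a *: w + w') z = a * H1_inner w z + H1_inner w' z.
Proof.
rewrite /H1_inner /= L2_inner_linear.
under eq_bigr do rewrite L2_inner_linear.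
by rewrite big_split/= -mulr_sumr mulrDr addrACA.
Qed.

Lemma H1_inner_ge0 w : 0 <= H1_inner w w.
Proof.
rewrite addr_ge0 ?L2_inner_ge0// sumr_ge0// => j _; exact: L2_inner_ge0.
Qed.

Lemma in_H1_linear a w w' : in_H1 w -> in_H1 w' -> in_H1 (a *: w + w').
Proof.
move=> Hw Hw' j f phi dphi tf fE dfE /=; rewrite !L2_inner_linear.
by rewrite (Hw j f phi dphi)// (Hw' j f phi dphi)// mulrN -opprD.
Qed.

Lemma L2_class_linear d' (T : measurableType d')
    (mu : {measure set T -> \bar R}) a (x y : L2 mu) (f g : T -> R) :
  x = f %[ae mu] -> y = g %[ae mu] ->
  (a *: x + y : L2 mu) = a *: f + g %[ae mu].
Proof.
move=> xf yg.
apply: filterS2 (filterI xf yg) (filterI (LpDE (a *: x) y) (LpZE a x)).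
move=> t [xf' yg'] [D Z] Tt; rewrite D// Z// xf'// yg'//.
Qed.

Lemma L2_zero_linear d' (T : measurableType d')
    (mu : {measure set T -> \bar R}) (P : T -> Prop) a (x y : L2 mu) :
  (\forall t \ae mu, P t -> x t = 0) -> (\forall t \ae mu, P t -> y t = 0) ->
  \forall t \ae mu, P t -> (a *: x + y : L2 mu) t = 0.
Proof.
move=> x0 y0.
apply: filterS2 (filterI x0 y0) (filterI (LpDE (a *: x) y) (LpZE a x)).
by move=> t [xt yt] [D Z] Pt; rewrite D// Z// xt// yt// mulr0 addr0.
Qed.

Lemma is_trace_linear a w w' g g' : is_trace w g -> is_trace w' g' ->
  is_trace (a *: w + w') (a *: g + g').
Proof.
move=> [f_ [w_ [g_ [fwg cw cg]]]] [f'_ [w'_ [g'_ [fwg' cw' cg']]]].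
exists (fun n => a *: f_ n + f'_ n), (fun n => a *: w_ n + w'_ n).
exists (fun n => a *: g_ n + g'_ n); split=> [n| |].
- have [sf wf dwf gf] := fwg n; have [sf' wf' dwf' gf'] := fwg' n; split.
  + exact: smooth_linear.
  + exact: L2_class_linear.
  + by move=> j; rewrite partial_linear//; exact: L2_class_linear.
  + exact: L2_class_linear.
- exact: (cvg_in_linear H1_inner_sym H1_inner_linear H1_inner_ge0).
- exact: (cvg_in_linear (@L2_inner_sym _ _ _ _) (@L2_inner_linear _ _ _ _)
    (@L2_inner_ge0 _ _ _ _)).
Qed.

Lemma L2_class0 d' (T : measurableType d')
    (mu : {measure set T -> \bar R}) : (0 : L2 mu) = (0 : T -> R) %[ae mu].
Proof. exact: Lp_piE. Qed.

Lemma L2_inner0 d' (T : measurableType d') (mu : {measure set T -> \bar R})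
  (z : L2 mu) : L2_inner 0 z = 0.
Proof.
have := L2_inner_linear (-1) 0 0 z.
by rewrite scaler0 add0r mulN1r addNr.
Qed.

Lemma is_trace0 : is_trace 0 0.
Proof.
exists (fun=> 0), (fun=> 0), (fun=> 0); split=> [n| |].
- split; [exact: smooth0|exact: L2_class0| |exact: L2_class0].
  by move=> j; rewrite partial0; exact: L2_class0.
- exact: (cvg_in_cst H1_inner_sym H1_inner_linear).
- exact: (cvg_in_cst (@L2_inner_sym _ _ _ _) (@L2_inner_linear _ _ _ _)).
Qed.

Lemma V_closed : submod_closed V_pred.
Proof.
split.
  apply/asboolP => i; split.
    by move=> j f phi dphi _ _ _; rewrite !L2_inner0 oppr0.
  exists 0; first exact: is_trace0.
  by apply: filterS (@L2_class0 _ _ surface_on) => x h _; rewrite h.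
move=> a v w /asboolP Vv /asboolP Vw; apply/asboolP => i.
have [Hv [g tg g0]] := Vv i; have [Hw [h th h0]] := Vw i.
split; first exact: (in_H1_linear a Hv Hw).
exists (a *: g + h); first exact: (is_trace_linear a tg th).
exact: L2_zero_linear.
Qed.

HB.instance Definition _ := GRing.isSubmodClosed.Build R _ V_pred V_closed.

(* the components v_i (v.1 i) and partial derivatives d v_i / d x_j (v.2 i j) *)
(* of a vector field v, with v_i in H^1(Omega) of zero trace on Gamma1        *)
Record V_space := MkV {
  V_val :> ('I_d -> L2O) * ('I_d -> 'I_d -> L2O);
  V_valP : V_val \in V_pred }.
HB.instance Definition _ := [isSub for V_val].
HB.instance Definition _ := [Choice of V_space by <:].
HB.instance Definition _ := [SubChoice_isSubLmodule of V_space by <:].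

Definition Q_pred (tau : 'I_d -> 'I_d -> L2O) : bool :=
  `[< forall i j, tau i j = tau j i >].

Lemma Q_closed : submod_closed Q_pred.
Proof.
split=> [|a x y /asboolP xs /asboolP ys]; apply/asboolP => // i j.
by rewrite !fctE xs ys.
Qed.

HB.instance Definition _ := GRing.isSubmodClosed.Build R _ Q_pred Q_closed.

Record Q_space := MkQ {
  Q_val :> 'I_d -> 'I_d -> L2O;
  Q_valP : Q_val \in Q_pred }.
HB.instance Definition _ := [isSub for Q_val].
HB.instance Definition _ := [Choice of Q_space by <:].
HB.instance Definition _ := [SubChoice_isSubLmodule of Q_space by <:].

End function_spaces.

Section operators.
Context (R : realType) (d : nat).
Variables (Omega Gamma1 : set 'rV[R]_d).
Local Notation V := (V_space Omega Gamma1).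
Local Notation Q := (Q_space Omega).

Definition Q_inner (sigma tau : Q) : R :=
  \sum_i \sum_j L2_inner (sigma i j) (tau i j).

Lemma Q_inner_sym sigma tau : Q_inner sigma tau = Q_inner tau sigma.
Proof.
by apply: eq_bigr => i _; apply: eq_bigr => j _; exact: L2_inner_sym.
Qed.

Lemma Q_inner_linear a sigma sigma' tau :
  Q_inner (a *: sigma + sigma') tau =
    a * Q_inner sigma tau + Q_inner sigma' tau.
Proof.
rewrite /Q_inner mulr_sumr -big_split; apply: eq_bigr => i _ /=.
rewrite mulr_sumr -big_split; apply: eq_bigr => j _ /=.
exact: L2_inner_linear.
Qed.

Lemma Q_inner_ge0 sigma : 0 <= Q_inner sigma sigma.
Proof. by do 2!apply: sumr_ge0 => ? _; exact: L2_inner_ge0. Qed.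

Definition Q_norm : Q -> R := ip_norm Q_inner.

Lemma eps_subproof (v : V) :
  (fun i j => 2^-1 *: ((V_val v).2 i j + (V_val v).2 j i))
    \in @Q_pred _ _ Omega.
Proof. by apply/asboolP => i j; rewrite addrC. Qed.

Definition eps (v : V) : Q := MkQ (eps_subproof v).

Lemma eps_linear a (u v : V) : eps (a *: u + v) = a *: eps u + eps v.
Proof.
apply/val_inj/funext => i; apply/funext => j /=.
rewrite !fctE /=.
by rewrite !scalerDr !scalerA (mulrC a) addrACA.
Qed.

Definition V_inner (u v : V) : R := Q_inner (eps u) (eps v).

Definition V_norm : V -> R := ip_norm V_inner.

Definition Vdual_pred (l : V -> R^o) : bool :=
  `[< (forall a u v, l (a *: u + v) = a * l u + l v) /\
      exists C : R, forall v, `|l v| <= C * V_norm v >].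

Lemma Vdual_closed : submod_closed Vdual_pred.
Proof.
split=> [|a k l /asboolP[klin [C kC]] /asboolP[llin [D lD]]]; apply/asboolP.
  split=> [b u v|]; first by rewrite -[LHS]/0 -[RHS]/(b * 0 + 0) mulr0 addr0.
  by exists 0 => v; rewrite mul0r -[X in `|X|]/0 normr0.
split=> [b u v|].
  rewrite -[LHS]/(a * k _ + l _) klin llin.
  by rewrite -[RHS]/(b * (a * k u + l u) + (a * k v + l v)); ring.
exists (`|a| * C + D) => v; rewrite -[X in `|X|]/(a * k v + l v) mulrDl -mulrA.
apply: le_trans (ler_normD _ _) _; rewrite lerD// normrM.
by rewrite ler_wpM2l.
Qed.

HB.instance Definition _ := GRing.isSubmodClosed.Build R _ Vdual_pred
  Vdual_closed.

Record Vdual := MkVdual { Vdual_val :> V -> R^o;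
                          Vdual_valP : Vdual_val \in Vdual_pred }.
HB.instance Definition _ := [isSub for Vdual_val].
HB.instance Definition _ := [Choice of Vdual by <:].
HB.instance Definition _ := [SubChoice_isSubLmodule of Vdual by <:].

Definition Vdual_norm (l : Vdual) : R :=
  sup [set `|l v| | v in [set v | V_norm v <= 1]].

Lemma eps_adj_subproof (eta : Q) :
  (fun v => Q_inner eta (eps v)) \in Vdual_pred.
Proof.
apply/asboolP; split=> [a u v|].
  by rewrite eps_linear Q_inner_sym Q_inner_linear !(Q_inner_sym _ eta).
exists (Q_norm eta) => v.
exact: (ip_cauchy_schwarz Q_inner_sym Q_inner_linear Q_inner_ge0).
Qed.

Definition eps_adj (eta : Q) : Vdual := MkVdual (eps_adj_subproof eta).

Local Notation Linf := (Linfty (volume_on Omega)).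

Local Notation index4 := ('I_d * 'I_d * ('I_d * 'I_d))%type.

Definition Qinf_pred (D : index4 -> Linf) : bool :=
  `[< forall i j k l, D (i, j, (k, l)) = D (j, i, (k, l)) /\
        D (i, j, (k, l)) = D (k, l, (i, j)) >].

Lemma Qinf_closed : submod_closed Qinf_pred.
Proof.
split=> [|a x y /asboolP xs /asboolP ys]; apply/asboolP => // i j k l.
have [x1 x2] := xs i j k l; have [y1 y2] := ys i j k l.
by split; rewrite !fctE; [rewrite x1 y1|rewrite x2 y2].
Qed.

HB.instance Definition _ := GRing.isSubmodClosed.Build R _ Qinf_pred
  Qinf_closed.

(* fourth order tensors, the component D_ijkl being D (i, j, (k, l))          *)
Record Qinf := MkQinf { Qinf_val :> index4 -> Linf;
                        Qinf_valP : Qinf_val \in Qinf_pred }.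
HB.instance Definition _ := [isSub for Qinf_val].
HB.instance Definition _ := [Choice of Qinf by <:].
HB.instance Definition _ := [SubChoice_isSubLmodule of Qinf by <:].

Definition Qinf_norm (D : Qinf) : R :=
  \big[Num.max/0]_(ijkl : index4) Lp_norm (D ijkl).

Lemma Qinf_act_subproof (D : Qinf) (tau : Q) :
  (fun i j => \sum_k \sum_l Linfty_mul (D (i, j, (k, l))) (tau k l))
    \in @Q_pred _ _ Omega.
Proof.
have /asboolP Ds := Qinf_valP D; apply/asboolP => i j.
by apply: eq_bigr => k _; apply: eq_bigr => l _; rewrite (Ds i j k l).1.
Qed.

Definition Qinf_act (D : Qinf) (tau : Q) : Q := MkQ (Qinf_act_subproof D tau).

(* int_0^t Rel(t - s) eps(u(s)) ds in Q                                       *)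
Definition memory (Rel : R -> Qinf) (u : R -> V) (t : R) : Q :=
  riemann_integral Q_norm (fun s => Qinf_act (Rel (t - s)) (eps (u s))) 0 t.

Definition monotone_op (P : V -> Vdual) : Prop :=
  forall u v, 0 <= (P u - P v) (u - v).

Definition Wop (B : Q -> Q) (v : V) : Vdual := eps_adj (B (eps v)).

(* the unique z in U such that <A z, v - z> >= <omega, v - z> for all v in U; *)
(* it exists if U is nonempty closed convex and A is Lipschitz continuous and *)
(* strongly monotone, and otherwise the value of xget is irrelevant           *)
Definition solution_op (U : set V) (A : V -> Vdual) (omega : Vdual) : V :=
  xget 0 [set z | U z /\ forall v, U v -> A z (v - z) >= omega (v - z)].

Definition solves_P (U : set V) (B : Q -> Q) (Rel : R -> Qinf)
    (P : V -> Vdual) (f : R -> Vdual) (T : R) (u : R -> V) : Prop :=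
  forall t, 0 <= t <= T -> U (u t) /\
    forall v, U v ->
      Q_inner (B (eps (u t))) (eps v - eps (u t))
      + Q_inner (memory Rel u t) (eps v - eps (u t))
      + P (u t) (v - u t) >= f t (v - u t).

Definition solves_Q (U : set V) (B : Q -> Q) (Rel : R -> Qinf)
    (P : V -> Vdual) (f : R -> Vdual) (T : R) (u : R -> V) : Prop :=
  forall t, 0 <= t <= T ->
    u t = solution_op U (fun z => Wop B z + P z)
      (f t - eps_adj (memory Rel u t)).

End operators.

(* Main.v *)
Require Import Defs.
From HB Require Import structures.
From mathcomp Require Import all_boot all_order all_algebra.
From mathcomp Require Import all_classical all_reals all_analysis.
From mathcomp Require Import ring lra.

(* For each t, both problems express the same variational inequality for      *)
(* W + P, since <eps^* eta, v> = (eta, eps v)_Q. As solution_op is a choice   *)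
(* operator, this settles the equivalence once that inequality has exactly    *)
(* one solution. Uniqueness is strong monotonicity of W + P; existence is the *)
(* Lions-Stampacchia theorem in a Hilbert space: minimizing                   *)
(* ip v v - 2 * l v over a closed convex set gives projections and the Riesz  *)
(* representation, and a projected gradient step is then a contraction.       *)

Set Implicit Arguments.
Unset Strict Implicit.
Unset Printing Implicit Defensive.

Import Order.TTheory GRing.Theory Num.Theory.
Import numFieldNormedType.Exports.

Local Open Scope classical_set_scope.
Local Open Scope ring_scope.

(** Fix t. Both problems contain the same memory term eta in Q, and the adjoint moves it to the
    right-hand side: the inequality of Problem P at t is the one characterizing F[f(t) - eps^* eta].
    [solution_opP] turns that characterization into an equation with [solution_op]. Its existence
    half is [variational_inequality], built on [energy_min], [ip_variational_inequality], [riesz]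
    and [contraction_fixpoint]; completeness of V makes minimizing sequences and Picard iterates
    converge. Strong monotonicity of W + P comes from coercivity of B and monotonicity of P, its
    Lipschitz bound from boundedness of B and the Lipschitz bound of P. *)

(** * Linear forms and inner product algebra *)

Section hilbert_space.
Context (R : realType) (E : lmodType R).

Definition is_linear_form (l : E -> R) :=
  forall a x y, l (a *: x + y) = a * l x + l y.

Lemma linear_formD (l : E -> R) : is_linear_form l ->
  forall x y, l (x + y) = l x + l y.
Proof. by move=> ll x y; have := ll 1 x y; rewrite scale1r mul1r. Qed.

Lemma linear_form0 (l : E -> R) : is_linear_form l -> l 0 = 0.
Proof.
by move=> ll; have := ll (-1) 0 0; rewrite scaler0 addr0 mulN1r addNr.
Qed.

Lemma linear_formZ (l : E -> R) : is_linear_form l ->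
  forall a x, l (a *: x) = a * l x.
Proof.
by move=> ll a x; have := ll a x 0; rewrite addr0 linear_form0// addr0.
Qed.

Lemma linear_formN (l : E -> R) : is_linear_form l ->
  forall x, l (- x) = - l x.
Proof. by move=> ll x; rewrite -scaleN1r linear_formZ// mulN1r. Qed.

Lemma linear_formB (l : E -> R) : is_linear_form l ->
  forall x y, l (x - y) = l x - l y.
Proof. by move=> ll x y; rewrite linear_formD// linear_formN. Qed.

Variable ip : E -> E -> R.
Hypothesis ip_hilbert : hilbert ip.
Local Notation N := (ip_norm ip).

Let ipC x y : ip x y = ip y x. Proof. by case: ip_hilbert. Qed.
Let ip_linear a x y z : ip (a *: x + y) z = a * ip x z + ip y z.
Proof. by case: ip_hilbert. Qed.
Let ip_ge0 x : 0 <= ip x x. Proof. by case: ip_hilbert. Qed.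
Let ip_l z : is_linear_form (ip^~ z). Proof. by move=> a x y /=. Qed.
Let ip_r z : is_linear_form (ip z).
Proof. by move=> a x y /=; rewrite ipC ip_linear !(ipC z). Qed.
Let ipDl x y z : ip (x + y) z = ip x z + ip y z.
Proof. exact: (linear_formD (ip_l z)). Qed.
Let ipDr z x y : ip z (x + y) = ip z x + ip z y.
Proof. exact: (linear_formD (ip_r z)). Qed.
Let ipNl x z : ip (- x) z = - ip x z.
Proof. exact: (linear_formN (ip_l z)). Qed.
Let ipNr z x : ip z (- x) = - ip z x.
Proof. exact: (linear_formN (ip_r z)). Qed.
Let ipZl a x z : ip (a *: x) z = a * ip x z.
Proof. exact: (linear_formZ (ip_l z)). Qed.
Let ipZr z a x : ip z (a *: x) = a * ip z x.
Proof. exact: (linear_formZ (ip_r z)). Qed.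
Let ipE := (ipDl, ipDr, (ipNl, ipNr), (ipZl, ipZr)).

Let N_ge0 x : 0 <= N x. Proof. exact: sqrtr_ge0. Qed.
Let NE x : N x ^+ 2 = ip x x. Proof. exact: sqr_sqrtr. Qed.
Let CS x y : `|ip x y| <= N x * N y. Proof. exact: ip_cauchy_schwarz. Qed.
Let ND x y : N (x + y) <= N x + N y. Proof. exact: ip_normD. Qed.

Definition bounded_form (l : E -> R) :=
  is_linear_form l /\ exists C, forall v, `|l v| <= C * N v.

Lemma ip_bounded_form y : bounded_form (ip y).
Proof. by split; [exact: ip_r|exists (N y)]. Qed.

Lemma bounded_formB l k : bounded_form l -> bounded_form k ->
  bounded_form (fun v => l v - k v).
Proof.
move=> [ll [C lC]] [kl [D kD]]; split=> [a x y|].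
  by rewrite ll kl; ring.
exists (C + D) => v; rewrite mulrDl.
by apply: le_trans (ler_normB _ _) _; rewrite lerD.
Qed.

Lemma natSinv_lt_eventually (e : R) : 0 < e ->
  exists M, forall n, (M <= n)%N -> n.+1%:R^-1 < e.
Proof.
move=> e0.
have [M _ HM] := near_infty_natSinv_lt (PosNum e0).
by exists M => n Mn; apply: HM.
Qed.

(** * Minimization, projection and Riesz representation *)

Lemma energy_min (K : set E) (l : E -> R) :
  K !=set0 -> closed_in N K -> convex_in K -> bounded_form l ->
  exists2 w, K w & forall v, K v -> ip w w - 2 * l w <= ip v v - 2 * l v.
Proof.
move=> [k0 Kk0] Kc Kconv [ll [C lC]].
pose J v := ip v v - 2 * l v.
(* Completing the square: J v >= N v ^ 2 - 2 C N v = (N v - C) ^ 2 - C ^ 2. *)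
have Jge v : - C ^+ 2 <= J v.
  rewrite /J -NE; have := lC v; have := ler_norm (l v).
  by have := sqr_ge0 (N v - C); nra.
pose S := [set J v | v in K].
have infS : has_inf S.
  split; first by exists (J k0), k0.
  by exists (- C ^+ 2) => _ [v _ <-].
have muJ v : K v -> inf S <= J v.
  by move=> Kv; apply: ge_inf; [case: infS|exists v].
have xn n : exists x, K x /\ J x < inf S + n.+1%:R^-1.
  have [_ [x Kx <-] ?] := @inf_adherent _ S n.+1%:R^-1 ltac:(by []) infS.
  by exists x.
have [x_ xP] := choice xn.
(* Parallelogram law: the linear parts cancel in 2 J x + 2 J y - 4 J((x + y) / 2) = N (x - y) ^ 2,
   and the midpoint lies in K. Hence minimizing sequences are Cauchy. *)
have para x y : K x -> K y ->
    N (x - y) ^+ 2 <= 2 * (J x - inf S) + 2 * (J y - inf S).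
  move=> Kx Ky.
  have half : 0 <= (2^-1 : R) <= 1 by apply/andP; split; lra.
  have := muJ _ (Kconv x y _ Kx Ky half).
  by rewrite NE /J !(ll, linear_formZ ll) !ipE (ipC y x); lra.
have [w xw] : exists w, cvg_in N x_ w.
  case: ip_hilbert => _ _ _ _; apply => e e0.
  have [|M HM] := @natSinv_lt_eventually (e ^+ 2 / 4).
    by rewrite divr_gt0 ?exprn_gt0.
  exists M => m n Mm Mn.
  have JM j : (M <= j)%N -> J (x_ j) - inf S < e ^+ 2 / 4.
    by move=> /HM; apply: lt_trans; rewrite ltrBlDl; exact: (xP j).2.
  rewrite -ltr_sqr ?nnegrE ?N_ge0 ?(ltW e0)//.
  apply: le_lt_trans (para _ _ (xP _).1 (xP _).1) _.
  by move: (JM m Mm) (JM n Mn); lra.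
have Kw : K w by apply: Kc xw => n; exact: (xP n).1.
exists w => // v /muJ; apply: le_trans.
(* Semicontinuity of J at w, made quantitative: expand J (x_ n) around w and drop the square. *)
have Jw n : J w <= inf S + n.+1%:R^-1 + 2 * (N w + C) * N (x_ n - w).
  have E1 : J (x_ n) = J w + 2 * ip w (x_ n - w) - 2 * l (x_ n - w)
      + N (x_ n - w) ^+ 2.
    by rewrite NE /J !(linear_formB ll) !ipE (ipC w); ring.
  move: (xP n).2 (CS w (x_ n - w)) (lC (x_ n - w)) (sqr_ge0 (N (x_ n - w))).
  rewrite E1; move: (ler_norm (l (x_ n - w))) (ler_norm (- ip w (x_ n - w))).
  rewrite normrN; move: (J w) (inf S) (n.+1%:R^-1) => *; lra.
have cv : (fun n => inf S + n.+1%:R^-1 + 2 * (N w + C) * N (x_ n - w)) @ \oo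
    --> inf S + 0 + 2 * (N w + C) * 0.
  apply: cvgD; first apply: cvgD; first exact: cvg_cst.
    exact: cvg_harmonic.
  by apply: cvgM => //; exact: cvg_cst.
rewrite mulr0 !addr0 in cv.
by apply: (cvgr_to_ge cv); exact: nearW.
Qed.

(* K = E gives the Riesz representation of l, l = ip y the projection of y    *)
(* on K.                                                                      *)
Lemma ip_variational_inequality (K : set E) (l : E -> R) :
  K !=set0 -> closed_in N K -> convex_in K -> bounded_form l ->
  exists2 w, K w & forall v, K v -> l (v - w) <= ip w (v - w).
Proof.
move=> K0 Kc Kconv bl.
have [w Kw wmin] := energy_min K0 Kc Kconv bl.
have [ll _] := bl.
exists w => // v Kv; rewrite leNgt; apply/negP => lt.
pose b := ip w (v - w) - l (v - w); pose c := ip (v - w) (v - w).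
have b0 : b < 0 by rewrite subr_lt0.
have c0 : 0 <= c by exact: ip_ge0.
have cb : 0 < c - b by lra.
(* J(w + t (v - w)) - J w = t (2 b + t c), and this t gives 2 b + t c = b (1 + t) < 0, against
   minimality. The denominator is positive even if c = 0. *)
pose t := - b / (c - b).
have tcb : t * (c - b) = - b by rewrite /t mulfVK// gt_eqF.
have t0 : 0 < t by rewrite divr_gt0// oppr_gt0.
have t1 : t <= 1 by rewrite ler_pdivrMr// mul1r; lra.
have := wmin _ (Kconv v w t Kv Kw ltac:(by rewrite (ltW t0) t1)).
have -> : t *: v + (1 - t) *: w = w + t *: (v - w).
  by rewrite scalerBl scale1r scalerBr addrC -addrA [- _ + _]addrC.
have -> : ip (w + t *: (v - w)) (w + t *: (v - w)) - 2 * l (w + t *: (v - w)) =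
    ip w w - 2 * l w + t * (2 * b + t * c).
  rewrite /b /c; move: (v - w) => h.
  by rewrite (linear_formD ll) (linear_formZ ll) !ipE (ipC h w); ring.
by nra.
Qed.

Lemma riesz (l : E -> R) : bounded_form l -> exists y, forall h, ip y h = l h.
Proof.
move=> bl; have [ll _] := bl.
have [|||//|w _ wP] := @ip_variational_inequality setT l; rewrite ?/closed_in//.
  by exists 0.
have ge h : l h <= ip w h by have := wP (h + w) I; rewrite addrK.
exists w => h; apply/eqP; rewrite eq_le ge andbT.
by have := ge (- h); rewrite (linear_formN ll) ipE lerN2.
Qed.

(** * Fixed points and the Lions-Stampacchia theorem *)

Lemma contraction_fixpoint (K : set E) (G : E -> E) (k : R) :
  K !=set0 -> closed_in N K -> (forall x, K x -> K (G x)) -> 0 <= k < 1 ->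
  (forall x y, N (G x - G y) <= k * N (x - y)) -> exists2 z, K z & G z = z.
Proof.
move=> [x0 Kx0] Kc KG /andP[k0 k1] Gk.
pose x_ n := iter n G x0; pose c := N (G x0 - x0).
have step n : N (x_ n.+1 - x_ n) <= k ^+ n * c.
  elim: n => [|n IH]; first by rewrite expr0 mul1r.
  by apply: le_trans (Gk _ _) _; rewrite exprS -mulrA ler_wpM2l.
have NC x y : N (x - y) = N (y - x) by rewrite -opprB /ip_norm ipNl ipNr opprK.
(* The geometric sum of the steps, multiplied by 1 - k so that the induction has no division. *)
have far n p : N (x_ (p + n)%N - x_ n) * (1 - k) <= (k ^+ n - k ^+ (p + n)) * c.
  elim: p => [|p IH].
    by rewrite !subrr /ip_norm (linear_form0 (ip_l _)) sqrtr0 !mul0r.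
  have -> : x_ (p.+1 + n)%N - x_ n =
      (x_ (p + n).+1 - x_ (p + n)%N) + (x_ (p + n)%N - x_ n).
    by rewrite addrA subrK.
  have := ND (x_ (p + n).+1 - x_ (p + n)%N) (x_ (p + n)%N - x_ n).
  by have := step (p + n)%N; rewrite addSn exprS; nra.
have farW n m : (n <= m)%N -> N (x_ m - x_ n) <= k ^+ n * c / (1 - k).
  move=> nm; rewrite ler_pdivlMr ?subr_gt0//.
  have := far n (m - n)%N; rewrite subnK// => /le_trans; apply.
  by rewrite ler_wpM2r ?N_ge0// gerBl exprn_ge0.
have cv0 : k ^+ n * c / (1 - k) @[n --> \oo] --> (0 : R).
  rewrite -[X in _ --> X](mul0r (1 - k)^-1) -[X in X * _](mul0r c).
  apply: cvgM; last exact: cvg_cst.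
  apply: cvgM; last exact: cvg_cst.
  by apply: cvg_expr; rewrite ger0_norm.
have [z xz] : exists z, cvg_in N x_ z.
  case: ip_hilbert => _ _ _ _; apply => e e0.
  have [M _ HM] := (cvgr0_norm_lt _ cv0) (e / 2) ltac:(by rewrite divr_gt0).
  exists M => m n Mm Mn.
  have e2 j : (M <= j)%N -> N (x_ j - x_ M) < e / 2.
    move=> /farW /le_lt_trans; apply; apply: le_lt_trans (ler_norm _) _.
    by apply: HM => /=.
  have := ND (x_ m - x_ M) (x_ M - x_ n); rewrite addrA subrK (NC (x_ M)).
  by move: (e2 m Mm) (e2 n Mn); lra.
exists z; first by apply: Kc xz => n; elim: n => //= n; exact: KG.
case: (ip_hilbert) => _ _ _ def _.
apply/eqP; rewrite -subr_eq0; apply/eqP/def; rewrite -NE.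
suff -> : N (G z - z) = 0 by rewrite expr0n.
apply/eqP; rewrite eq_le N_ge0 andbT.
have le n : N (G z - z) <= k * N (x_ n - z) + N (x_ n.+1 - z).
  have := ND (G z - x_ n.+1) (x_ n.+1 - z); rewrite addrA subrK.
  by have := Gk (x_ n) z; rewrite (NC (G z) (x_ n.+1)) /x_ /=; lra.
have cv : k * N (x_ n - z) + N (x_ n.+1 - z) @[n --> \oo] --> k * 0 + 0.
  apply: cvgD; first by apply: cvgM => //; exact: cvg_cst.
  by have := xz; rewrite /cvg_in -(cvg_shiftS (fun n => N (x_ n - z))).
rewrite mulr0 addr0 in cv.
by apply: (cvgr_to_ge cv); exact: nearW.
Qed.

(* With a the Riesz representative of A and rho = m / max(L, m) ^ 2, the map  *)
(* sending z to the projection on K of z - rho * a z is a contraction; its    *)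
(* fixed points are the solutions.                                            *)
Lemma variational_inequality (K : set E) (A : E -> E -> R) (m L : R) :
  K !=set0 -> closed_in N K -> convex_in K -> 0 < m ->
  (forall z, bounded_form (A z)) ->
  (forall x y h, `|A x h - A y h| <= L * N (x - y) * N h) ->
  (forall x y, m * N (x - y) ^+ 2 <= A x (x - y) - A y (x - y)) ->
  exists2 z, K z & forall v, K v -> 0 <= A z (v - z).
Proof.
move=> K0 Kc Kconv m0 Ab Alip Amono.
have [a aP] := choice (fun z => riesz (Ab z)).
(* The maximum with m makes M positive whatever L is, and gives m / M <= 1. *)
pose M := Num.max L m.
have M0 : 0 < M by rewrite lt_max m0 orbT.
(* Test the bound on A with h = a x - a y, then cancel one factor N h. *)
have alip x y : N (a x - a y) <= M * N (x - y).
  have [->|n0] := eqVneq (N (a x - a y)) 0; first by rewrite mulr_ge0 ?(ltW M0).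
  rewrite -(@ler_pM2r _ (N (a x - a y))) ?lt_def ?n0 ?N_ge0//.
  rewrite -expr2 NE ipDl ipNl !aP; apply: le_trans (ler_norm _) _.
  apply: le_trans (Alip _ _ _) _.
  by rewrite !ler_wpM2r ?N_ge0// /M le_max lexx.
pose rho := m / M ^+ 2.
have rho0 : 0 < rho by rewrite divr_gt0// exprn_gt0.
have projP z : exists w, K w /\
    forall v, K v -> ip (z - rho *: a z) (v - w) <= ip w (v - w).
  have [w] := ip_variational_inequality K0 Kc Kconv
    (ip_bounded_form (z - rho *: a z)).
  by exists w.
have [G GP] := choice projP.
(* The value of 1 - 2 rho m + rho ^ 2 M ^ 2 at its minimizer rho = m / M ^ 2. *)
pose q := 1 - (m / M) ^+ 2.
have mM : m / M <= 1 by rewrite ler_pdivrMr// mul1r /M le_max lexx orbT.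
have mM0 : 0 < m / M by rewrite divr_gt0.
have q0 : 0 <= q by rewrite /q; nra.
have q1 : q < 1 by rewrite /q; nra.
have [|||z Kz Gz] := @contraction_fixpoint K G (Num.sqrt q) K0 Kc.
- by move=> x _; case: (GP x).
- by rewrite sqrtr_ge0 -sqrtr1 ltr_sqrt.
- move=> x y.
  (* Projections are firmly nonexpansive: add the inequalities of G x and G y, each tested at the
     other point. *)
  have d2 : N (G x - G y) ^+ 2 <= ip (x - y - rho *: (a x - a y)) (G x - G y).
    have := (GP x).2 _ (GP y).1; have := (GP y).2 _ (GP x).1.
    by rewrite NE !ipE; lra.
  have n2 : N (x - y - rho *: (a x - a y)) ^+ 2 <= q * N (x - y) ^+ 2.
    have -> : q = 1 - 2 * rho * m + rho ^+ 2 * M ^+ 2.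
      by rewrite /q /rho; field; rewrite gt_eqF.
    have -> : N (x - y - rho *: (a x - a y)) ^+ 2 = N (x - y) ^+ 2
        - 2 * rho * (A x (x - y) - A y (x - y)) + rho ^+ 2 * N (a x - a y) ^+ 2.
      rewrite !NE -!aP; move: (x - y) (a x) (a y) => h b c.
      by rewrite !ipE !(ipC h) (ipC c b); ring.
    have := alip x y.
    rewrite -ler_sqr ?nnegrE ?mulr_ge0 ?N_ge0 ?(ltW M0)// exprMn.
    by have := Amono x y; nra.
  have nq : N (x - y - rho *: (a x - a y)) <= Num.sqrt q * N (x - y).
    rewrite -ler_sqr ?nnegrE ?mulr_ge0 ?sqrtr_ge0 ?N_ge0// exprMn.
    by rewrite (sqr_sqrtr q0).
  have [->|n0] := eqVneq (N (G x - G y)) 0.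
    by rewrite mulr_ge0 ?sqrtr_ge0.
  have ngt0 : 0 < N (G x - G y) by rewrite lt_def n0 N_ge0.
  rewrite -(ler_pM2r ngt0) -expr2; apply: le_trans d2 _.
  apply: le_trans (ler_norm _) _; apply: le_trans (CS _ _) _.
  by rewrite ler_wpM2r.
exists z => // v Kv.
have := (GP z).2 v Kv; rewrite Gz ipDl ipNl ipZl aP.
by move=> ?; rewrite -(pmulr_rge0 _ rho0); lra.
Qed.

End hilbert_space.

(** * Bounded operators and well-posedness for W + P *)

Lemma continuous_linear_bounded (R : realType) (E F : lmodType R)
    (nE : E -> R) (nF : F -> R) (f : {linear E -> F}) :
  (forall a x, nE (a *: x) = `|a| * nE x) ->
  (forall a x, nF (a *: x) = `|a| * nF x) ->
  (forall x, 0 <= nE x) -> continuous_in nE nF f ->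
  exists2 C, 0 <= C & forall x, nF (f x) <= C * nE x.
Proof.
move=> nEZ nFZ nE0 /(_ 0 1 ltr01)[delta d0 fd].
exists delta^-1 => [|x]; first by rewrite invr_ge0 ltW.
rewrite mulrC ler_pdivlMr//; apply/ler_addgt0Pr => e e0.
have r0 : 0 < nE x + e by rewrite ltr_wpDl.
(* The margin e keeps the scaling defined when nE x = 0 and puts a x strictly inside the
   delta-ball. *)
pose a := delta / (nE x + e).
have a0 : 0 < a by rewrite divr_gt0.
have := fd (a *: x); rewrite !subr0 linear0 subr0 linearZ nEZ nFZ gtr0_norm//.
have -> : a * nE x < delta by rewrite mulrAC ltr_pdivrMr// ltr_pM2l// ltrDl.
by move=> /(_ isT)/ltW; rewrite mulrAC ler_pdivrMr// mul1r mulrC.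
Qed.

Section well_posedness.
Context (R : realType) (d : nat) (Omega Gamma1 : set 'rV[R]_d).
Local Notation V := (V_space Omega Gamma1).
Local Notation Q := (Q_space Omega).
Local Notation Vdual := (Vdual Omega Gamma1).
Local Notation VN := (@V_norm R d Omega Gamma1).
Local Notation QN := (@Q_norm R d Omega).

Lemma Vdual_bounded_form (l : Vdual) :
  bounded_form (@V_inner R d Omega Gamma1) l.
Proof. by have /asboolP[ll [C lC]] := Vdual_valP l; split=> //; exists C. Qed.

Lemma V_normE (v : V) : VN v = QN (eps v).
Proof. by []. Qed.

Lemma VdualB (k l : Vdual) v : (k - l) v = k v - l v.
Proof. by []. Qed.

Lemma epsB (u v : V) : eps (u - v) = eps u - eps v.
Proof. by rewrite -scaleN1r addrC eps_linear scaleN1r addrC. Qed.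

Lemma Q_normZ a (tau : Q) : QN (a *: tau) = `|a| * QN tau.
Proof.
exact: (ip_normZ (@Q_inner_sym R d Omega) (@Q_inner_linear R d Omega)).
Qed.

Lemma Q_cauchy_schwarz (sigma tau : Q) :
  `|Q_inner sigma tau| <= QN sigma * QN tau.
Proof.
exact: (ip_cauchy_schwarz (@Q_inner_sym R d Omega) (@Q_inner_linear R d Omega)
  (@Q_inner_ge0 R d Omega)).
Qed.

Lemma Q_inner_subl (sigma sigma' tau : Q) :
  Q_inner (sigma - sigma') tau = Q_inner sigma tau - Q_inner sigma' tau.
Proof. by rewrite addrC -scaleN1r Q_inner_linear mulN1r addrC. Qed.

Lemma Vdual_norm_bound (l : Vdual) v : `|l v| <= Vdual_norm l * VN v.
Proof.
have [ll [C lC]] := Vdual_bounded_form l.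
have VNZ a w : VN (a *: w) = `|a| * VN w.
  rewrite !V_normE -Q_normZ; congr QN.
  have := eps_linear a w 0; rewrite addr0.
  by have := epsB (0 : V) 0; rewrite !subrr => ->; rewrite addr0.
have VN0 w : 0 <= VN w by exact: sqrtr_ge0.
have supS : has_sup [set `|l v| | v in [set v | VN v <= 1]].
  split; first by exists `|l 0|, 0; rewrite //= -(scale0r 0) VNZ normr0 mul0r.
  exists `|C| => _ [w /= w1 <-]; apply: le_trans (lC w) _.
  have := ler_norm C; have := VN0 w; have := normr_ge0 C.
  by rewrite /V_norm in w1 *; nra.
(* A vector of norm 0 cannot be normalized; there the bound C of l forces l v = 0. *)
have [v0|v0] := eqVneq (VN v) 0.
  by have := lC v; rewrite -/(VN v) v0 !mulr0.
have vgt0 : 0 < VN v by rewrite lt_def v0 VN0.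
rewrite -ler_pdivrMr//; apply: sup_ubound; first by case: supS.
exists ((VN v)^-1 *: v); first by rewrite /= VNZ ger0_norm ?invr_ge0// mulVf.
by rewrite (linear_formZ ll) normrM ger0_norm ?invr_ge0// mulrC.
Qed.

Section operator.
Variables (B : {linear Q -> Q}) (P : V -> Vdual).

Lemma Wop_addB (w z h : V) :
  (Wop B w + P w) h - (Wop B z + P z) h =
    Q_inner (B (eps (w - z))) (eps h) + (P w - P z) h.
Proof.
rewrite epsB linearB Q_inner_subl VdualB.
rewrite -[(Wop B w + P w) h]/(Q_inner (B (eps w)) (eps h) + P w h).
rewrite -[(Wop B z + P z) h]/(Q_inner (B (eps z)) (eps h) + P z h).
by rewrite opprD addrACA.
Qed.

(** A nonempty solution set makes [xget] return a solution; uniqueness makes every solution equal to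
    it. *)
Lemma solution_opP (U : set V) (omega : Vdual) :
  hilbert (@V_inner R d Omega Gamma1) -> U !=set0 -> closed_in VN U ->
  convex_in U -> continuous_in QN QN B ->
  (exists2 m : R, 0 < m & forall tau, m * QN tau ^+ 2 <= Q_inner (B tau) tau) ->
  lipschitz_in VN (@Vdual_norm R d Omega Gamma1) P -> monotone_op P ->
  forall z, z = solution_op U (fun z => Wop B z + P z) omega <->
    U z /\ forall v, U v -> omega (v - z) <= (Wop B z + P z) (v - z).
Proof.
move=> VH U0 Uc Uconv Bc [m m0 Bm] [L PL] Pmono z.
have mono x y : m * VN (x - y) ^+ 2 <=
    (Wop B x + P x) (x - y) - (Wop B y + P y) (x - y).
  by rewrite Wop_addB V_normE; have := Bm (eps (x - y)); have := Pmono x y; lra.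
have [C C0 BC] := continuous_linear_bounded Q_normZ Q_normZ
  (fun=> sqrtr_ge0 _) Bc.
set S := [set z | U z /\
  forall v, U v -> omega (v - z) <= (Wop B z + P z) (v - z)].
have ex : S !=set0.
  (* Subtracting omega makes the right-hand side 0 and leaves differences in z unchanged; C bounds
     the part from B, L the part from P. *)
  have [|x y h|x y|y Uy yP] := @variational_inequality R V _ VH U
      (fun z h => (Wop B z + P z) h - omega h) m (C + L) U0 Uc Uconv m0.
  - by move=> y; apply: bounded_formB; exact: Vdual_bounded_form.
  - have -> : (Wop B x + P x) h - omega h - ((Wop B y + P y) h - omega h) =
      (Wop B x + P x) h - (Wop B y + P y) h by ring.
    rewrite Wop_addB; apply: le_trans (ler_normD _ _) _.
    rewrite !mulrDl lerD//.
      apply: le_trans (Q_cauchy_schwarz _ _) _.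
      by rewrite ler_wpM2r ?sqrtr_ge0// V_normE.
    apply: le_trans (Vdual_norm_bound _ _) _.
    by rewrite ler_wpM2r ?sqrtr_ge0.
  - by apply: le_trans (mono x y) _; rewrite opprB addrA subrK.
  - by exists y; split=> // v /yP; rewrite subr_ge0.
have uniq x y : S x -> S y -> x = y.
  move=> [Ux xP] [Uy yP].
  (* Each solution is tested at the other; the omega terms cancel against strong monotonicity. *)
  have xy0 : VN (x - y) = 0.
    have : m * VN (x - y) ^+ 2 <= 0.
      apply: le_trans (mono x y) _; rewrite subr_le0.
      apply: le_trans (yP x Ux); have := xP y Uy.
      by rewrite -(opprB x y) !(linear_formN (Vdual_bounded_form _).1) lerN2.
    rewrite pmulr_rle0// => n0; apply/eqP.
    by rewrite -sqrf_eq0 eq_le n0 sqr_ge0.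
  case: VH => _ _ ge0 def _; apply/eqP; rewrite -subr_eq0; apply/eqP/def.
  by rewrite -(sqr_sqrtr (ge0 _)) -[Num.sqrt _]/(VN (x - y)) xy0 expr0n.
have Ssol : S (solution_op U (fun z => Wop B z + P z) omega).
  by case: ex => y; exact: xgetI.
by split=> [->//|Sz]; exact: uniq.
Qed.

End operator.

End well_posedness.

Theorem theorem2 (R : realType) (d : nat) (Omega Gamma1 : set 'rV[R]_d) (T : R)
    (d_range : (1 <= d <= 3)%N)
    (Omega_domain : bounded_smooth_domain Omega)
    (Gamma1_boundary : Gamma1 `<=` boundary Omega)
    (Gamma1_measurable : (@hausdorff_outer R d d.-1).-caratheodory Gamma1)
    (Gamma1_pos : (0 < hausdorff_outer d.-1 Gamma1)%E)
    (T_pos : 0 < T)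
    (V_hilbert : hilbert (@V_inner R d Omega Gamma1))
    (U : set (V_space Omega Gamma1))
    (U_nonempty : U !=set0)
    (U_closed : closed_in (@V_norm R d Omega Gamma1) U)
    (U_convex : convex_in U)
    (B : {linear Q_space Omega -> Q_space Omega})
    (B_continuous : continuous_in (@Q_norm R d Omega) (@Q_norm R d Omega) B)
    (B_coercive : exists2 m : R, 0 < m &
       forall tau, m * Q_norm tau ^+ 2 <= Q_inner (B tau) tau)
    (Rel : R -> Qinf Omega)
    (Rel_continuous : continuous_on_time (@Qinf_norm R d Omega) T Rel)
    (P : V_space Omega Gamma1 -> Vdual Omega Gamma1)
    (P_lipschitz : lipschitz_in (@V_norm R d Omega Gamma1)
       (@Vdual_norm R d Omega Gamma1) P)
    (P_monotone : monotone_op P)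
    (f : R -> Vdual Omega Gamma1)
    (f_continuous : continuous_on_time (@Vdual_norm R d Omega Gamma1) T f)
    (u : R -> V_space Omega Gamma1)
    (u_continuous : continuous_on_time (@V_norm R d Omega Gamma1) T u)
    (u_in_U : forall t, 0 <= t <= T -> U (u t)) :
  solves_P U B Rel P f T u <-> solves_Q U B Rel P f T u.
Proof.
have Qform (eta : Q_space Omega) z v :
    Q_inner eta (eps v - eps z) = eps_adj Gamma1 eta (v - z).
  by rewrite -epsB.
have sol t := solution_opP (f t - eps_adj Gamma1 (memory Rel u t)) V_hilbert
  U_nonempty U_closed U_convex B_continuous B_coercive P_lipschitz P_monotone (u t).
(* The adjoint identity [Qform] turns both Q-products into pairings, and the memory term changes
   sides. *)
have ineq t v : (f t (v - u t) <= Q_inner (B (eps (u t))) (eps v - eps (u t))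
      + Q_inner (memory Rel u t) (eps v - eps (u t)) + P (u t) (v - u t)) =
    ((f t - eps_adj Gamma1 (memory Rel u t)) (v - u t) <=
      (Wop B (u t) + P (u t)) (v - u t)).
  by rewrite !Qform VdualB lerBlDr addrAC.
split=> [uP t /uP[Uu uP']|uQ t tT].
  by apply/(sol t); split=> // v Uv; rewrite -ineq; exact: uP'.
have /(sol t)[Uu uP] := uQ t tT.
by split=> // v Uv; rewrite ineq; exact: uP.
Qed.
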